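(* Assume $f$ is not identically zero on the set of feasible allocations. (1) If the lift-one algorithm or the modified lift-one algorithm converges (i.e. reaches an allocation $\mathbf p$ with $f(\mathbf p_*^{(i)})=f(\mathbf p)$ for every $i=1,\dots,2^k$), then the resulting allocation $\mathbf p$ maximizes $|X'WX|$ on the set of feasible allocations. (2) The modified lift-one algorithm is guaranteed to converge: for every admissible starting allocation and every choice of the orders of indices used, either it converges after finitely many iterations in the sense of (1), or the infinite sequence of allocations $\mathbf p_0,\mathbf p_1,\mathbf p_2,\dots$ obtained after successive iterations satisfies $\lim_{n\to\infty}f(\mathbf p_n)=\max_{\mathbf p}f(\mathbf p)$, the maximum being over all feasible allocations.
   Context: Setting: $k\ge 1$ factors at two levels $\pm1$. The $2^k$ experimental conditions are the elements of $\{-1,1\}^k$, listed in some order. The model matrix $X$ is a $2^k\times(d+1)$ matrix with entries $\pm1$, $d\ge k$, whose $i$th row corresponds to the $i$th experimental condition $(x_1,\dots,x_k)$. Its first column is all ones (intercept); the other $d$ columns are distinct and consist of the $k$ main effects $x_1,\dots,x_k$ and, possibly, some interactions (products $\prod_{j\in S}x_j$ with $S\subseteq\{1,\dots,k\}$, $|S|\ge2$). Let $w_1,\dots,w_{2^k}\ge0$ be given real constants. A feasible allocation is $\mathbf p=(p_1,\dots,p_{2^k})'$ with $p_i\ge0$ and $\sum_i p_i=1$. Put $W=\mathrm{diag}\{w_1p_1,\dots,w_{2^k}p_{2^k}\}$ and $f(\mathbf p)=|X'WX|$ (determinant). For $\mathbf p$ with $f(\mathbf p)>0$ (then all $p_i<1$)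 and $0\le z\le1$ let $$f_i(z)=f\left(\tfrac{1-z}{1-p_i}p_1,\dots,\tfrac{1-z}{1-p_i}p_{i-1},z,\tfrac{1-z}{1-p_i}p_{i+1},\dots,\tfrac{1-z}{1-p_i}p_{2^k}\right).$$ One has $f_i(z)=a_iz(1-z)^d+b_i(1-z)^{d+1}$, where: if $p_i>0$, $b_i=f_i(0)$ and $a_i=\frac{f(\mathbf p)-b_i(1-p_i)^{d+1}}{p_i(1-p_i)^d}$; if $p_i=0$, $b_i=f(\mathbf p)$ and $a_i=2^{d+1}f_i(\frac12)-b_i$. Let $z_*$ be the maximizer of $f_i$ on $[0,1]$, given by $z_*=\frac{a_i-b_i(d+1)}{(a_i-b_i)(d+1)}$ if $a_i>b_i(d+1)$ and $z_*=0$ otherwise, and let $$\mathbf p_*^{(i)}=\left(\tfrac{1-z_*}{1-p_i}p_1,\dots,\tfrac{1-z_*}{1-p_i}p_{i-1},z_*,\tfrac{1-z_*}{1-p_i}p_{i+1},\dots,\tfrac{1-z_*}{1-p_i}p_{2^k}\right)',$$ so $f(\mathbf p_*^{(i)})=f_i(z_* )$. Lift-one algorithm: start with any feasible allocation with $0<p_i<1$ for all $i$. In each iteration, choose a (random) order of the indices $1,\dots,2^k$, go through the indices $i$ in this order, and for each $i$ compute $\mathbf p_*^{(i)}$ from the current allocation and replace the current allocation by $\mathbf p_*^{(i)}$. Repeat iterations until convergence, that is, until $f(\mathbf p)=f(\mathbf p_*^{(i)})$ for each $i$, where $\mathbf p$ is the current allocation. Modified lift-one algorithm: the same, except that in iterations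 number $10,20,30,\dots$ the allocation is not updated immediately; instead $\mathbf p_*^{(i)}$ is computed for every $i=1,\dots,2^k$ from the allocation $\mathbf p$ at the beginning of that iteration, and (if some $\mathbf p_*^{(i)}$ is better than $\mathbf p$) $\mathbf p$ is replaced by the first one among $\mathbf p_*^{(1)},\dots,\mathbf p_*^{(2^k)}$ having the largest value of $f$. $\mathbf p_0$ denotes the starting allocation and $\mathbf p_n$ the allocation after $n$ iterations. *)

(* Defs.v *)
From HB Require Import structures.
From mathcomp Require Import all_boot all_order all_algebra all_fingroup.
From mathcomp Require Import all_classical all_reals all_analysis.

Set Implicit Arguments.
Unset Strict Implicit.
Unset Printing Implicit Defensive.

Import Order.TTheory GRing.Theory Num.Theory.
Import numFieldNormedType.Exports.

Local Open Scope classical_set_scope.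
Local Open Scope ring_scope.

Definition conditions (R : realType) (k : nat) : set 'rV[R]_k :=
  [set v | forall j, v 0 j = 1 \/ v 0 j = -1].

Definition lists_conditions (R : realType) (k : nat)
    (x : 'I_(2 ^ k) -> 'rV[R]_k) : Prop :=
  set_bij [set: 'I_(2 ^ k)] (@conditions R k) x.

Definition main_effect (R : realType) (k : nat) (x : 'I_(2 ^ k) -> 'rV[R]_k)
    (j : 'I_k) : 'cV[R]_(2 ^ k) :=
  \col_i x i 0 j.

Definition interaction (R : realType) (k : nat) (x : 'I_(2 ^ k) -> 'rV[R]_k)
    (S : {set 'I_k}) : 'cV[R]_(2 ^ k) :=
  \col_i \prod_(j in S) x i 0 j.

(* Column 0 is the intercept; [lift ord0 l] runs over the other [d] columns. *)
Definition model_matrix (R : realType) (k d : nat)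
    (x : 'I_(2 ^ k) -> 'rV[R]_k) (X : 'M[R]_(2 ^ k, d.+1)) : Prop :=
  [/\ col ord0 X = const_mx 1,
      injective (fun l : 'I_d => col (lift ord0 l) X),
      forall j : 'I_k, exists l : 'I_d,
        col (lift ord0 l) X = main_effect x j
    & forall l : 'I_d,
        (exists j : 'I_k, col (lift ord0 l) X = main_effect x j) \/
        (exists S : {set 'I_k},
           (2 <= #|S|)%N /\ col (lift ord0 l) X = interaction x S)].

Definition feasible (R : realType) (N : nat) (p : 'rV[R]_N) : Prop :=
  (forall i, 0 <= p 0 i) /\ \sum_i p 0 i = 1.

Definition objective (R : realType) (N d : nat) (X : 'M[R]_(N, d.+1))
    (w p : 'rV[R]_N) : R :=
  \det (X^T *m diag_mx (\row_i (w 0 i * p 0 i)) *m X).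

Definition maximizes (R : realType) (N d : nat) (X : 'M[R]_(N, d.+1))
    (w p : 'rV[R]_N) : Prop :=
  feasible p /\ forall q, feasible q -> objective X w q <= objective X w p.

(* Only meaningful when [p 0 i < 1], as is the case whenever [p] is feasible
   with nonzero objective and [0 < d]. *)
Definition lift_alloc (R : realType) (N : nat) (p : 'rV[R]_N) (i : 'I_N)
    (z : R) : 'rV[R]_N :=
  \row_j (if j == i then z else (1 - z) / (1 - p 0 i) * p 0 j).

Definition lifted_objective (R : realType) (N d : nat) (X : 'M[R]_(N, d.+1))
    (w p : 'rV[R]_N) (i : 'I_N) (z : R) : R :=
  objective X w (lift_alloc p i z).

(* [coef_a] and [coef_b] are the coefficients in
   [lifted_objective X w p i z = a * z * (1 - z) ^+ d + b * (1 - z) ^+ d.+1]. *)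
Definition coef_b (R : realType) (N d : nat) (X : 'M[R]_(N, d.+1))
    (w p : 'rV[R]_N) (i : 'I_N) : R :=
  if p 0 i == 0 then objective X w p else lifted_objective X w p i 0.

Definition coef_a (R : realType) (N d : nat) (X : 'M[R]_(N, d.+1))
    (w p : 'rV[R]_N) (i : 'I_N) : R :=
  let b := coef_b X w p i in
  if p 0 i == 0 then 2 ^+ d.+1 * lifted_objective X w p i (1 / 2) - b
  else (objective X w p - b * (1 - p 0 i) ^+ d.+1)
       / (p 0 i * (1 - p 0 i) ^+ d).

Definition zstar (R : realType) (N d : nat) (X : 'M[R]_(N, d.+1))
    (w p : 'rV[R]_N) (i : 'I_N) : R :=
  let a := coef_a X w p i in
  let b := coef_b X w p i in
  if b * d.+1%:R < a then (a - b * d.+1%:R) / ((a - b) * d.+1%:R) else 0.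

Definition pstar (R : realType) (N d : nat) (X : 'M[R]_(N, d.+1))
    (w p : 'rV[R]_N) (i : 'I_N) : 'rV[R]_N :=
  lift_alloc p i (zstar X w p i).

(* The indices are visited in the order [s 0, s 1, ..., s (N - 1)]. *)
Definition sequential_iteration (R : realType) (N d : nat)
    (X : 'M[R]_(N, d.+1)) (w : 'rV[R]_N) (s : {perm 'I_N}) (p : 'rV[R]_N) :
    'rV[R]_N :=
  foldl (pstar X w) p [seq s i | i <- enum 'I_N].

(* [enum 'I_N] is increasing, so [find] selects the least index attaining the
   largest objective value. *)
Definition simultaneous_iteration (R : realType) (N d : nat)
    (X : 'M[R]_(N, d.+1)) (w p : 'rV[R]_N) : 'rV[R]_N :=
  let c := [seq pstar X w p i | i <- enum 'I_N] in
  let largest q := all (fun q' => objective X w q' <= objective X w q) c in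
  if has (fun q => objective X w p < objective X w q) c
  then nth p c (find largest c) else p.

(* [lift_one X w s p0 n] and [modified_lift_one X w s p0 n] are the allocations
   after [n] iterations; iteration number [m.+1] uses the order [s m]. The
   stopping rule is not built in: it is expressed by [converges_to]. *)
Fixpoint lift_one (R : realType) (N d : nat) (X : 'M[R]_(N, d.+1))
    (w : 'rV[R]_N) (s : nat -> {perm 'I_N}) (p0 : 'rV[R]_N) (n : nat) :
    'rV[R]_N :=
  if n is m.+1
  then sequential_iteration X w (s m) (lift_one X w s p0 m)
  else p0.

Fixpoint modified_lift_one (R : realType) (N d : nat) (X : 'M[R]_(N, d.+1))
    (w : 'rV[R]_N) (s : nat -> {perm 'I_N}) (p0 : 'rV[R]_N) (n : nat) :
    'rV[R]_N :=
  if n is m.+1 then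
    let p := modified_lift_one X w s p0 m in
    if (10 %| m.+1)%N then simultaneous_iteration X w p
    else sequential_iteration X w (s m) p
  else p0.

Definition admissible_start (R : realType) (N : nat) (p : 'rV[R]_N) : Prop :=
  feasible p /\ forall i, 0 < p 0 i < 1.

Definition stationary (R : realType) (N d : nat) (X : 'M[R]_(N, d.+1))
    (w p : 'rV[R]_N) : Prop :=
  forall i, objective X w (pstar X w p i) = objective X w p.

Definition converges_to (R : realType) (N d : nat) (X : 'M[R]_(N, d.+1))
    (w : 'rV[R]_N) (u : nat -> 'rV[R]_N) (p : 'rV[R]_N) : Prop :=
  exists n, u n = p /\ stationary X w p.

(* Main.v *)
Require Import Defs.
From HB Require Import structures.
From mathcomp Require Import all_boot all_order all_algebra all_fingroup.
From mathcomp Require Import all_classical all_reals all_analysis.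
From mathcomp Require Import ring lra zify.

Set Implicit Arguments.
Unset Strict Implicit.
Unset Printing Implicit Defensive.

Import Order.TTheory GRing.Theory Num.Theory.
Import numFieldNormedType.Exports.

Local Open Scope classical_set_scope.
Local Open Scope ring_scope.

(** The information matrix M(p) = X'WX is linear in p and positive
semidefinite, and moving p towards the vertex e_i of the simplex adds a
rank-one matrix to a multiple of it.  The determinant is affine in a rank-one
perturbation, so along the segment from p to e_i the objective is
(1 - t)^d ((1 - t) f(p) + t g_i(p)), where g_i(p) = f(p + e_i) - f(p)
([objective_mix]).  Applied at the point with zero i-th weight, this gives the
polynomial that the lift-one step maximizes: a scalar inequality of Young type
shows that z_* is its maximizer on [0, 1] ([lifted_poly_max], [pstar_max]).  In
particular a step never decreases f, and it beats every point of the segment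
from p to e_i.

Suppose that f(p) > 0 and that f does not increase along any of these segments
([maximizes_of_mix_le]).  Differentiating at t = 0 gives
g_i(p) <= (d + 1) f(p).  When M(p) is invertible, the q-weighted sum of the
g_i(p) is f(p) tr(M(p)^-1 M(q)); hence this trace is at most d + 1 for every
feasible q.  The arithmetic-geometric mean inequality for determinants,
det Q <= det P (tr(P^-1 Q) / n)^n, then yields f(q) <= f(p)
([det_le_trace_rel]).  It follows from a Cholesky factorization P = L L', which
reduces it to P = 1, and from Hadamard's inequality.  This settles stationary
allocations.

For the modified algorithm, f increases along the iterations and is bounded, so
it has a limit L.  Every tenth iteration replaces p by an allocation at least as
good as all the candidates, so its gain in f bounds from above the increase of f
along every segment from p to a vertex; these gains tend to 0.  At a cluster
point q of the allocations that precede these iterations, continuity gives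
f(q) = L > 0 and no increase along any segment, so q is a maximizer
([simultaneous_limit_maximum]). *)

(** * Positive semidefinite matrices *)

Definition psd (R : rcfType) (n : nat) (A : 'M[R]_n) : Prop :=
  A^T = A /\ forall v : 'rV[R]_n, 0 <= (v *m A *m v^T) 0 0.

Lemma row_sqr_ge0 (R : realFieldType) n (v : 'rV[R]_n) :
  0 <= (v *m v^T) 0 0.
Proof.
by rewrite mxE; apply: sumr_ge0 => j _; rewrite !mxE -expr2 sqr_ge0.
Qed.

Lemma row_sqr_eq0 (R : realFieldType) n (v : 'rV[R]_n) :
  (v *m v^T) 0 0 = 0 -> v = 0.
Proof.
rewrite mxE => /psumr_eq0P v0; apply/rowP => j; rewrite mxE.
have /eqP : v 0 j * v^T j 0 = 0.
  by apply: v0 => // l _; rewrite !mxE -expr2 sqr_ge0.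
by rewrite mxE mulf_eq0 orbb => /eqP.
Qed.

Lemma form_block_mx (R : rcfType) n (a : R) (b : 'rV[R]_n) (C : 'M[R]_n)
    (x : R) (y : 'rV[R]_n) :
  let v := row_mx x%:M y in
  (v *m block_mx a%:M b b^T C *m v^T) 0 0 =
  a * x ^+ 2 + 2 * x * (b *m y^T) 0 0 + (y *m C *m y^T) 0 0.
Proof.
rewrite /= mul_row_block tr_row_mx mul_row_col !mulmxDl tr_scalar_mx.
have -> : y *m b^T *m x%:M = x%:M *m b *m y^T.
  by rewrite mul_mx_scalar mul_scalar_mx -scalemxAl -[RHS]trmxK
     linearZ /= trmx_mul trmxK [(x *: _)]mx11_scalar tr_scalar_mx.
rewrite -!scalar_mxM !mul_scalar_mx -!scalemxAl.
set u := b *m y^T; set t := y *m C *m y^T.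
by rewrite !mxE /= !mulr1n; ring.
Qed.

(** The factor is allowed to be singular, so that the same statement yields
Hadamard's inequality for every positive semidefinite matrix.  By induction on
the size: split off the first row and factor the Schur complement of the corner
entry. *)
Lemma psd_cholesky (R : rcfType) n (A : 'M[R]_n) :
  psd A -> exists2 L : 'M[R]_n, is_trig_mx L & A = L *m L^T.
Proof.
elim: n A => [|n IH] A.
  by exists 0; [apply/is_trig_mxP => -[] | apply/matrixP => -[]].
rewrite -[n.+1]/(1 + n)%N in A * => -[symA].
set a := ulsubmx A 0 0; set b := ursubmx A; set C := drsubmx A.
have defA : A = block_mx a%:M b b^T C.
  by rewrite -[LHS]submxK -[dlsubmx A]trmxK trmx_dlsub symA -mx11_scalar.
have symC : C^T = C by rewrite trmx_drsub symA.
rewrite defA => posA.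
have q_ge0 x (y : 'rV_n) : 0 <= a * x ^+ 2 + 2 * x * (b *m y^T) 0 0
                      + (y *m C *m y^T) 0 0.
  by rewrite -form_block_mx.
have a_ge0 : 0 <= a.
  have := q_ge0 1 0.
  by rewrite trmx0 !mulmx0 mxE !mulr0 !addr0 expr1n mulr1.
have [a0|a_neq0] := eqVneq a 0.
  (* If the corner vanishes, so does the rest of its row: the form is affine
     in [x] and would otherwise become negative. *)
  have b0 : b = 0.
    apply: row_sqr_eq0; apply/eqP; rewrite eq_le row_sqr_ge0 andbT.
    rewrite leNgt; apply/negP => bb_gt0.
    set c := (b *m C *m b^T) 0 0.
    have := q_ge0 (- (c + 1) / (2 * (b *m b^T) 0 0)) b.
    rewrite a0 mul0r add0r -/c.
    have -> : 2 * (- (c + 1) / (2 * (b *m b^T) 0 0)) * (b *m b^T) 0 0 + c = -1.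
      by field; rewrite gt_eqF.
    by rewrite oppr_ge0 ler10.
  have [|L trigL defC] := IH C.
    split=> // y; have := q_ge0 0 y.
    by rewrite expr0n /= !mulr0 mul0r !add0r.
  exists (block_mx 0 0 0 L).
    by rewrite is_trig_block_mx // eqxx mx0_is_trig.
  by rewrite a0 b0 tr_block_mx mulmx_block !trmx0 !mulmx0 !mul0mx !addr0 !add0r
    -defC raddf0.
have a_gt0 : 0 < a by rewrite lt_def a_neq0.
have [|L trigL defS] := IH (C - a^-1 *: (b^T *m b)).
  split=> [|y]; first by rewrite linearB linearZ /= trmx_mul trmxK symC.
  have := q_ge0 (- (b *m y^T) 0 0 / a) y.
  have bbE : (y *m (a^-1 *: (b^T *m b)) *m y^T) 0 0
             = a^-1 * (b *m y^T) 0 0 ^+ 2.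
    rewrite -scalemxAr -scalemxAl !mulmxA -[y *m b^T]trmxK trmx_mul trmxK.
    by rewrite -mulmxA mxE mxE big_ord1 [_^T _ _]mxE expr2.
  rewrite mulmxBr mulmxBl [X in _ -> 0 <= X]mxE [X in _ -> 0 <= _ + X]mxE bbE.
  by congr (_ <= _); field.
have sq_a : Num.sqrt a * Num.sqrt a = a by rewrite -expr2 sqr_sqrtr.
have sq_neq0 : Num.sqrt a != 0 by rewrite gt_eqF // sqrtr_gt0.
exists (block_mx (Num.sqrt a)%:M 0 ((Num.sqrt a)^-1 *: b^T) L).
  by rewrite is_trig_block_mx // eqxx scalar_mx_is_trig.
rewrite tr_block_mx mulmx_block !trmx0 !mulmx0 !mul0mx !addr0 tr_scalar_mx.
rewrite -scalar_mxM sq_a mul_scalar_mx mul_mx_scalar linearZ /= trmxK !scalerA.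
rewrite divff // !scale1r -defS -scalemxAl -scalemxAr scalerA.
by rewrite -invfM sq_a addrC subrK.
Qed.

(** With A = L L' and L triangular, the determinant is the product of the
squares of the L i i, while A i i is the sum of the squares of the whole row i
of L. *)
Lemma hadamard_ineq (R : rcfType) n (A : 'M[R]_n) :
  psd A -> 0 <= \det A <= \prod_i A i i.
Proof.
move=> /psd_cholesky[L trigL ->].
rewrite det_mulmx det_tr -expr2 sqr_ge0 det_trig // -prodrXl /=.
apply: ler_prod => i _; rewrite sqr_ge0 mxE (bigD1 i) //= mxE -expr2 lerDl.
by apply: sumr_ge0 => j _; rewrite mxE -expr2 sqr_ge0.
Qed.

Lemma psd_diag_ge0 (R : rcfType) n (A : 'M[R]_n) i : psd A -> 0 <= A i i.
Proof.
move=> [_ /(_ (delta_mx 0 i))]; rewrite -rowE trmx_delta -colE.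
by rewrite !mxE.
Qed.

Lemma det_le_trace (R : rcfType) n (A : 'M[R]_n) :
  psd A -> \det A <= (\tr A / n%:R) ^+ n.
Proof.
move=> psdA; have /andP[_ /le_trans] := hadamard_ineq psdA; apply.
have := @leif_AGM R 'I_n predT (fun i => A i i).
by rewrite card_ord => -[i _|]; first exact: psd_diag_ge0.
Qed.

Lemma psd_congr (R : rcfType) m n (B : 'M[R]_(m, n)) (A : 'M[R]_n) :
  psd A -> psd (B *m A *m B^T).
Proof.
move=> [symA posA]; split=> [|v]; first by rewrite !trmx_mul trmxK symA mulmxA.
by have := posA (v *m B); rewrite trmx_mul !mulmxA.
Qed.

(** Writing P = L L', the congruence by the inverse of L turns P into the
identity and Q into a positive semidefinite A whose trace is that of P^-1 Q, so
that [det_le_trace] applies to A.  The sign of the trace is recorded because the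
power on the right is monotone only for nonnegative arguments. *)
Lemma det_le_trace_rel (R : rcfType) n (P Q : 'M[R]_n) :
  psd P -> \det P != 0 -> psd Q ->
  0 <= \tr (invmx P *m Q) /\
  \det Q <= \det P * (\tr (invmx P *m Q) / n%:R) ^+ n.
Proof.
move=> /psd_cholesky[L _ defP] detP_neq0 psdQ.
have unitL : L \in unitmx.
  by move: detP_neq0; rewrite defP det_mulmx mulf_eq0 unitmxE unitfE => /norP[].
pose A := invmx L *m Q *m (invmx L)^T.
have defQ : Q = L *m A *m L^T.
  by rewrite /A trmx_inv !mulmxA mulmxV // mul1mx mulmxKV // unitmx_tr.
have -> : \det Q = \det P * \det A.
  by rewrite defQ defP !det_mulmx; ring.
have -> : \tr (invmx P *m Q) = \tr A.
  have unitP : P \in unitmx by rewrite unitmxE unitfE.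
  have -> : invmx P = (invmx L)^T *m invmx L.
    rewrite -[RHS](mulKmx unitP) {3}defP trmx_inv.
    by rewrite [X in _ *m X]mulmxA mulmxK ?unitmx_tr // mulmxV // mulmx1.
  by rewrite -mulmxA mxtrace_mulC.
have psdA : psd A by exact: psd_congr.
split; first by apply: sumr_ge0 => i _; exact: psd_diag_ge0.
rewrite ler_wpM2l ?det_le_trace //.
by rewrite defP det_mulmx det_tr -expr2 sqr_ge0.
Qed.

(** * Rank-one perturbations of a determinant *)

(** Bordering moves the rank-one term to a single row of a larger matrix, where
the scalar [t] enters linearly; this is what makes [det_rank1_affine] hold over
any commutative ring, with no invertibility assumption on [A]. *)
Lemma det_bordered (R : comNzRingType) n (A : 'M[R]_n) (u : 'cV[R]_n)
    (v : 'rV[R]_n) (t : R) :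
  \det (block_mx 1%:M (- (t *: v)) u A) = \det (A + t *: (u *m v)).
Proof.
have -> : block_mx 1%:M (- (t *: v)) u A =
    block_mx 1%:M 0 u 1%:M *m block_mx 1%:M (- (t *: v)) 0 (A + t *: (u *m v)).
  rewrite mulmx_block !mulmx0 !mul0mx !mul1mx !mulmx1 !addr0 mulmxN -scalemxAr.
  by rewrite addrCA addNr addr0.
by rewrite det_mulmx det_lblock det_ublock !det1 !mul1r.
Qed.

Lemma det_rank1_affine (R : comNzRingType) n (A : 'M[R]_n) (u : 'cV[R]_n)
    (v : 'rV[R]_n) (t : R) :
  \det (A + t *: (u *m v)) = (1 - t) * \det A + t * \det (A + u *m v).
Proof.
have -> : A + u *m v = A + 1 *: (u *m v) by rewrite scale1r.
have -> : \det A = \det (A + 0 *: (u *m v)) by rewrite scale0r addr0.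
rewrite -!det_bordered.
apply: (determinant_multilinear (i0 := lshift n (ord0 : 'I_1))); last 2 first.
- by rewrite /block_mx !row'Ku; rewrite ![row' _ _]flatmx0.
- by rewrite /block_mx !row'Ku; rewrite ![row' _ _]flatmx0.
rewrite /block_mx !rowKu !row_id !scale_row_mx add_row_mx.
rewrite scale0r scale1r oppr0 scaler0 add0r scalerN -scalerDl subrK scale1r.
by [].
Qed.

(** The other elimination in the bordered matrix of [det_bordered], which uses
the inverse of [A] to clear the row [v]. *)
Lemma det_rank1_unit (R : comUnitRingType) n (A : 'M[R]_n) (u : 'cV[R]_n)
    (v : 'rV[R]_n) :
  A \in unitmx ->
  \det (A + u *m v) = \det A * (1 + (v *m invmx A *m u) 0 0).
Proof.
move=> unitA; rewrite -[X in \det (A + X)]scale1r -det_bordered scale1r.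
have -> : block_mx 1%:M (- v) u A =
    block_mx (1%:M + v *m invmx A *m u) (- v *m invmx A) 0 1%:M
    *m block_mx 1%:M 0 u A.
  rewrite mulmx_block !mulmx0 !mul0mx !mul1mx !mulmx1 !add0r mulmxKV //.
  by rewrite mulNmx mulNmx addrK.
rewrite det_mulmx det_lblock det_ublock !det1 mul1r mulr1 mulrC.
by rewrite det_mx11 !mxE.
Qed.

(** * The one-variable maximization *)

(** The tangent inequality for the convex function x ^+ d.+1, homogenized.  The
induction step adds (s ^+ d.+1 - t ^+ d.+1) * (s - t), which is nonnegative
because both factors have the same sign. *)
Lemma young_expr (R : realDomainType) d (s t : R) :
  0 <= s -> 0 <= t -> d.+1%:R * (s * t ^+ d) <= s ^+ d.+1 + d%:R * t ^+ d.+1.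
Proof.
move=> s0 t0; elim: d => [|d IH]; first by rewrite !mul1r mul0r addr0 mulr1.
have cheb : 0 <= (s ^+ d.+1 - t ^+ d.+1) * (s - t).
  have [st|/ltW ts] := leP s t.
    by rewrite mulr_le0 // subr_le0 // lerXn2r.
  by rewrite mulr_ge0 // subr_ge0 // lerXn2r.
have D1 : d.+1%:R = d%:R + 1 :> R by rewrite -natr1.
have D2 : d.+2%:R = d%:R + 2 :> R by rewrite -addn2 natrD.
rewrite -subr_ge0.
have -> : s ^+ d.+2 + d.+1%:R * t ^+ d.+2 - d.+2%:R * (s * t ^+ d.+1) =
    (s ^+ d.+1 - t ^+ d.+1) * (s - t)
    + t * (s ^+ d.+1 + d%:R * t ^+ d.+1 - d.+1%:R * (s * t ^+ d)).
  by rewrite D1 D2 !exprS; ring.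
by rewrite addr_ge0 // mulr_ge0 // subr_ge0.
Qed.

(** In the variable y = 1 - z, both cases are instances of [young_expr]: at the
critical point y0 if it lies in the interval, and at y0 = 1 otherwise, in which
case [a] may first be replaced by its upper bound. *)
Lemma lifted_poly_max (R : realFieldType) d (a b : R) :
  (0 < d)%N -> 0 <= b ->
  let h z := (1 - z) ^+ d * ((1 - z) * b + z * a) in
  let z0 := if b * d.+1%:R < a then (a - b * d.+1%:R) / ((a - b) * d.+1%:R)
            else 0 in
  0 <= z0 <= 1 /\ forall z, 0 <= z <= 1 -> h z <= h z0.
Proof.
move=> d_gt0 b_ge0 h z0.
have D : d.+1%:R = d%:R + 1 :> R by rewrite -natr1.
have dR : 1 <= d%:R :> R by rewrite ler1n.
rewrite /z0; case: ltP => [ba|ab]; last first.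
  split=> [|z /andP[z0' z1]]; first by rewrite lexx ler01.
  rewrite /h subr0 expr1n !mul1r mul0r addr0.
  have y0 : 0 <= 1 - z by rewrite subr_ge0.
  have := young_expr d ler01 y0; rewrite mul1r expr1n => young.
  apply: (@le_trans _ _ ((1 - z) ^+ d * ((1 - z) * b + z * (b * d.+1%:R)))).
    by rewrite ler_wpM2l ?exprn_ge0 // lerD2l ler_wpM2l.
  have -> : (1 - z) ^+ d * ((1 - z) * b + z * (b * d.+1%:R)) =
      b * (d.+1%:R * (1 - z) ^+ d - d%:R * (1 - z) ^+ d.+1).
    by rewrite D exprS; ring.
  by rewrite ler_piMr // lerBlDr.
have c_gt0 : 0 < a - b.
  by rewrite subr_gt0 (le_lt_trans _ ba) // ler_peMr // ler1n.
have cD_gt0 : 0 < (a - b) * d.+1%:R by rewrite mulr_gt0 // ltr0n.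
have a_gt0 : 0 < a by rewrite (le_lt_trans _ ba) // mulr_ge0.
set z1 := (a - b * d.+1%:R) / _.
(* [y0] is the critical point in the variable [y = 1 - z]; it turns the
   polynomial into [c / d * y ^+ d * (d.+1 * y0 - d * y)]. *)
pose y0 := d%:R * a / ((a - b) * d.+1%:R).
have z1E : z1 = 1 - y0.
  by rewrite /z1 /y0 D; field; rewrite -D !gt_eqF.
have y0_ge0 : 0 <= y0.
  exact: divr_ge0 (mulr_ge0 (ler0n _ _) (ltW a_gt0)) (ltW cD_gt0).
have z1_ge0 : 0 <= z1 by apply: divr_ge0; rewrite ?subr_ge0 ltW.
have hE z : h z = (a - b) / d%:R *
    (d.+1%:R * (y0 * (1 - z) ^+ d) - d%:R * (1 - z) ^+ d.+1).
  rewrite /h /y0 exprS D; field.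
  by rewrite -D !gt_eqF // ltr0n.
split=> [|z /andP[z_ge0 z_le1]].
  by rewrite z1_ge0 z1E gerBl.
rewrite !hE z1E subKr; apply: ler_wpM2l.
  exact: divr_ge0 (ltW c_gt0) (ler0n _ _).
have -> : d.+1%:R * (y0 * y0 ^+ d) - d%:R * y0 ^+ d.+1 = y0 ^+ d.+1.
  by rewrite D exprS; ring.
by rewrite lerBlDr young_expr // subr_ge0.
Qed.

(** * The objective along segments to vertices *)

Definition information (R : realType) (N d : nat) (X : 'M[R]_(N, d.+1))
    (w p : 'rV[R]_N) : 'M[R]_d.+1 :=
  X^T *m diag_mx (\row_i (w 0 i * p 0 i)) *m X.

Lemma information_sum (R : realType) (N d : nat) (X : 'M[R]_(N, d.+1))
    (w p : 'rV[R]_N) :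
  information X w p =
  \sum_i (w 0 i * p 0 i) *: ((row i X)^T *m row i X).
Proof.
apply/matrixP => a b; rewrite summxE mxE; apply: eq_bigr => i _.
by rewrite mul_mx_diag !mxE big_ord1 !mxE; ring.
Qed.

Lemma informationD (R : realType) (N d : nat) (X : 'M[R]_(N, d.+1))
    (w p q : 'rV[R]_N) :
  information X w (p + q) = information X w p + information X w q.
Proof.
rewrite !information_sum -big_split; apply: eq_bigr => i _ /=.
by rewrite -scalerDl !mxE mulrDr.
Qed.

Lemma informationZ (R : realType) (N d : nat) (X : 'M[R]_(N, d.+1))
    (w p : 'rV[R]_N) (c : R) :
  information X w (c *: p) = c *: information X w p.
Proof.
rewrite !information_sum scaler_sumr; apply: eq_bigr => i _.
by rewrite scalerA !mxE mulrCA.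
Qed.

Lemma information_point (R : realType) (N d : nat) (X : 'M[R]_(N, d.+1))
    (w : 'rV[R]_N) (i : 'I_N) :
  information X w (delta_mx 0 i) = (w 0 i *: (row i X)^T) *m row i X.
Proof.
rewrite information_sum (bigD1 i) //= big1 => [|j ji].
  by rewrite addr0 mxE !eqxx mulr1 scalemxAl.
by rewrite mxE (negPf ji) andbF mulr0 scale0r.
Qed.

Lemma information_form (R : realType) (N d : nat) (X : 'M[R]_(N, d.+1))
    (w p : 'rV[R]_N) (v : 'rV[R]_d.+1) :
  (v *m information X w p *m v^T) 0 0 =
  \sum_i w 0 i * p 0 i * (X *m v^T) i 0 ^+ 2.
Proof.
rewrite information_sum mulmx_sumr mulmx_suml summxE; apply: eq_bigr => i _.
rewrite -scalemxAr -scalemxAl mxE; congr (_ * _).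
have -> : v *m ((row i X)^T *m row i X) *m v^T =
    (row i (X *m v^T))^T *m row i (X *m v^T).
  by rewrite row_mul trmx_mul trmxK !mulmxA.
by rewrite mxE big_ord1 ![_^T _ _]mxE ![row _ _ _ _]mxE expr2.
Qed.

Lemma information_psd (R : realType) (N d : nat) (X : 'M[R]_(N, d.+1))
    (w p : 'rV[R]_N) :
  (forall i, 0 <= w 0 i) -> (forall i, 0 <= p 0 i) -> psd (information X w p).
Proof.
move=> w0 p0; split=> [|v].
  by rewrite /information !trmx_mul tr_diag_mx trmxK mulmxA.
rewrite information_form; apply: sumr_ge0 => i _.
by rewrite mulr_ge0 ?sqr_ge0 // mulr_ge0.
Qed.

Lemma objective_ge0 (R : realType) (N d : nat) (X : 'M[R]_(N, d.+1))
    (w p : 'rV[R]_N) :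
  (forall i, 0 <= w 0 i) -> (forall i, 0 <= p 0 i) -> 0 <= objective X w p.
Proof.
by move=> w0 p0; case/andP: (hadamard_ineq (information_psd X w0 p0)).
Qed.

(** A vector in the kernel of the information matrix at a positive allocation
kills every term of the quadratic form, hence every rank-one summand, and
therefore lies in the kernel at any other allocation. *)
Lemma objective_gt0 (R : realType) (N d : nat) (X : 'M[R]_(N, d.+1))
    (w p q : 'rV[R]_N) :
  (forall i, 0 <= w 0 i) -> (forall i, 0 < p 0 i) ->
  objective X w q <> 0 -> 0 < objective X w p.
Proof.
move=> w0 p0 fq; rewrite lt_def objective_ge0 // => [|i]; last exact: ltW.
rewrite andbT; apply/negP => /det0P[v v_neq0 vM0]; apply: fq; apply/eqP.
apply/det0P; exists v => //.
have /psumr_eq0P v0 : \sum_i w 0 i * p 0 i * (X *m v^T) i 0 ^+ 2 = 0.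
  by rewrite -information_form /information vM0 mul0mx mxE.
rewrite -/(information X w q) information_sum mulmx_sumr big1 // => i _.
have /eqP : w 0 i * p 0 i * (X *m v^T) i 0 ^+ 2 = 0.
  by apply: v0 => // j _; rewrite mulr_ge0 ?sqr_ge0 // mulr_ge0 // ltW.
rewrite mulf_eq0 sqrf_eq0 mulf_eq0 (gt_eqF (p0 i)) orbF => /orP[/eqP->|/eqP Xv].
  by rewrite mul0r scale0r mulmx0.
have -> : v *m ((w 0 i * q 0 i) *: ((row i X)^T *m row i X)) =
    (w 0 i * q 0 i) *: ((row i (X *m v^T))^T *m row i X).
  by rewrite -scalemxAr row_mul trmx_mul trmxK !mulmxA.
have -> : row i (X *m v^T) = 0 by apply/rowP => j; rewrite ord1 mxE Xv mxE.
by rewrite trmx0 mul0mx scaler0.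
Qed.

Lemma objectiveZ (R : realType) (N d : nat) (X : 'M[R]_(N, d.+1))
    (w p : 'rV[R]_N) (c : R) :
  objective X w (c *: p) = c ^+ d.+1 * objective X w p.
Proof. by rewrite -detZ -informationZ. Qed.

(** The segment from [p] to the vertex [i] of the simplex; [lift_alloc] follows
the same line, with the weight of [i] as its parameter. *)
Definition mix (R : realType) (N : nat) (p : 'rV[R]_N) (i : 'I_N) (t : R) :
    'rV[R]_N :=
  (1 - t) *: p + t *: delta_mx 0 i.

(** The slope of the objective in the weight of condition [i]: the objective is
affine in each weight separately, so the increment over a unit step is the
partial derivative. *)
Definition gain (R : realType) (N d : nat) (X : 'M[R]_(N, d.+1))
    (w p : 'rV[R]_N) (i : 'I_N) : R :=
  objective X w (p + delta_mx 0 i) - objective X w p.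

Lemma objective_add_point (R : realType) (N d : nat) (X : 'M[R]_(N, d.+1))
    (w p : 'rV[R]_N) (i : 'I_N) (s : R) :
  objective X w (p + s *: delta_mx 0 i) = objective X w p + s * gain X w p i.
Proof.
rewrite /gain /objective -!/(information _ _ _) !informationD informationZ.
rewrite information_point det_rank1_affine; ring.
Qed.

(** The matrix at a vertex has rank at most 1 and size at least 2.  That its
determinant is 0 is seen by comparing the degree d + 1 of homogeneity with the
linear growth of [objective_add_point]. *)
Lemma objective_point (R : realType) (N d : nat) (X : 'M[R]_(N, d.+1))
    (w : 'rV[R]_N) (i : 'I_N) :
  (0 < d)%N -> objective X w (delta_mx 0 i) = 0.
Proof.
move=> d_gt0; set e := delta_mx 0 i.
have f0 : objective X w 0 = 0.
  by rewrite -(scale0r 0) objectiveZ expr0n mul0r.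
have := objective_add_point X w 0 i 2.
rewrite /gain !add0r f0 subr0 objectiveZ add0r => /eqP.
rewrite -subr_eq0 -mulrBl mulf_eq0 => /orP[|/eqP//].
by rewrite subr_eq0 gt_eqF // exprS ltr_pMr // exprn_egt1 ?ltr1n // -lt0n.
Qed.

Lemma objective_mix (R : realType) (N d : nat) (X : 'M[R]_(N, d.+1))
    (w p : 'rV[R]_N) (i : 'I_N) (t : R) :
  (0 < d)%N ->
  objective X w (mix p i t) =
  (1 - t) ^+ d * ((1 - t) * objective X w p + t * gain X w p i).
Proof.
move=> d_gt0; have [->|t_neq1] := eqVneq t 1.
  rewrite /mix subrr scale0r add0r scale1r objective_point //.
  by rewrite expr0n eqn0Ngt d_gt0 mul0r.
have y_neq0 : 1 - t != 0 by rewrite subr_eq0 eq_sym.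
have -> : mix p i t = (1 - t) *: (p + (t / (1 - t)) *: delta_mx 0 i).
  by rewrite scalerDr scalerA mulrCA divff // mulr1.
by rewrite objectiveZ objective_add_point exprS; field.
Qed.

Lemma lift_alloc_mix (R : realType) (N : nat) (p : 'rV[R]_N) (i : 'I_N)
    (z : R) :
  lift_alloc p i z = mix (lift_alloc p i 0) i z.
Proof.
apply/rowP => j; rewrite !mxE eqxx /=; case: eqP => _ /=; ring.
Qed.

Lemma mix_lift_alloc (R : realType) (N : nat) (p : 'rV[R]_N) (i : 'I_N)
    (t : R) :
  p 0 i != 1 ->
  mix p i t = lift_alloc p i (p 0 i + t * (1 - p 0 i)).
Proof.
rewrite eq_sym -subr_eq0 => pi1; apply/rowP => j; rewrite !mxE eqxx /=.
by case: eqP => [->|_] /=; field.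
Qed.

Lemma lift_alloc_id (R : realType) (N : nat) (p : 'rV[R]_N) (i : 'I_N) :
  p 0 i != 1 -> lift_alloc p i (p 0 i) = p.
Proof.
move=> /(mix_lift_alloc 0); rewrite mul0r addr0 => <-.
by rewrite /mix subr0 scale0r addr0 scale1r.
Qed.

(** When [p 0 i] is 0 the lift to 0 is [p] itself, so the two cases in the
definition of the coefficient describe the same number. *)
Lemma coef_bE (R : realType) (N d : nat) (X : 'M[R]_(N, d.+1))
    (w p : 'rV[R]_N) (i : 'I_N) :
  p 0 i != 1 -> coef_b X w p i = objective X w (lift_alloc p i 0).
Proof.
move=> pi1; rewrite /coef_b; case: eqP => // pi0.
by rewrite -pi0 lift_alloc_id.
Qed.

Lemma coef_aE (R : realType) (N d : nat) (X : 'M[R]_(N, d.+1))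
    (w p : 'rV[R]_N) (i : 'I_N) :
  (0 < d)%N -> p 0 i != 1 -> coef_a X w p i = gain X w (lift_alloc p i 0) i.
Proof.
move=> d_gt0 pi1; rewrite /coef_a coef_bE //.
have y_neq0 : 1 - p 0 i != 0 by rewrite subr_eq0 eq_sym.
case: eqP => [pi0|/eqP pi_neq0].
  rewrite /lifted_objective lift_alloc_mix objective_mix //.
  have half : 2 * (1 - 1 / 2) = 1 :> R by field.
  rewrite mulrA exprS -(mulrA 2) -exprMn half expr1n.
  by field.
rewrite -{1}(lift_alloc_id pi1) [lift_alloc p i (p 0 i)]lift_alloc_mix.
rewrite objective_mix // exprS; field.
by rewrite expf_neq0.
Qed.

Lemma lifted_objectiveE (R : realType) (N d : nat) (X : 'M[R]_(N, d.+1))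
    (w p : 'rV[R]_N) (i : 'I_N) (z : R) :
  (0 < d)%N -> p 0 i != 1 ->
  lifted_objective X w p i z =
  (1 - z) ^+ d * ((1 - z) * coef_b X w p i + z * coef_a X w p i).
Proof.
move=> d_gt0 pi1; rewrite /lifted_objective lift_alloc_mix objective_mix //.
by rewrite coef_bE // coef_aE.
Qed.

(** * Lift-one steps *)

Lemma feasible_le1 (R : realType) (N : nat) (p : 'rV[R]_N) (i : 'I_N) :
  feasible p -> p 0 i <= 1.
Proof.
move=> [p0 <-]; rewrite (bigD1 i) //= lerDl.
by apply: sumr_ge0.
Qed.

Lemma feasible_mix (R : realType) (N : nat) (p : 'rV[R]_N) (i : 'I_N) (t : R) :
  0 <= t <= 1 -> feasible p -> feasible (mix p i t).
Proof.
move=> /andP[t0 t1] [p0 p1]; split=> [j|].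
  by rewrite !mxE addr_ge0 // mulr_ge0 // ?subr_ge0 // ler0n.
under eq_bigr => j do rewrite !mxE /=.
rewrite big_split /= -!mulr_sumr p1 (bigD1 i) //= eqxx.
rewrite big1 ?addr0 => [|j /negPf->//].
by rewrite !mulr1 subrK.
Qed.

Lemma feasible_point_of_eq1 (R : realType) (N : nat) (p : 'rV[R]_N) (i : 'I_N) :
  feasible p -> p 0 i = 1 -> p = delta_mx 0 i.
Proof.
move=> [p0 p1] pi1; apply/rowP => j; rewrite mxE eqxx /=.
have [->//|ji] := eqVneq j i.
move: p1; rewrite (bigD1 i) //= pi1 -[RHS]addr0.
by move=> /addrI/psumr_eq0P; apply.
Qed.

Lemma feasible_lift_alloc (R : realType) (N : nat) (p : 'rV[R]_N) (i : 'I_N)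
    (z : R) :
  p 0 i != 1 -> 0 <= z <= 1 -> feasible p -> feasible (lift_alloc p i z).
Proof.
move=> pi1 z01 feas_p; rewrite lift_alloc_mix; apply: feasible_mix => //.
have y_gt0 : 0 < 1 - p 0 i by rewrite subr_gt0 lt_neqAle pi1 feasible_le1.
case: feas_p => p0 p1; split=> [j|].
  by rewrite mxE; case: eqP => // _; rewrite mulr_ge0 // subr0 divr_ge0 // ltW.
rewrite (bigD1 i) //= mxE eqxx add0r.
under eq_bigr => j /negPf ji do rewrite mxE ji.
rewrite -mulr_sumr subr0 div1r; apply: (mulfI (lt0r_neq0 y_gt0)).
rewrite mulVKf ?gt_eqF // mulr1; move: p1; rewrite (bigD1 i) //= => <-.
by rewrite [X in X - _]addrC addrK.
Qed.

(** The invariant preserved by every step.  It makes all the lifts meaningful,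
since for d > 0 no weight of such an allocation can be 1. *)
Definition nondegenerate (R : realType) (N d : nat) (X : 'M[R]_(N, d.+1))
    (w p : 'rV[R]_N) : Prop :=
  feasible p /\ 0 < objective X w p.

Lemma nondegenerate_neq1 (R : realType) (N d : nat) (X : 'M[R]_(N, d.+1))
    (w p : 'rV[R]_N) (i : 'I_N) :
  (0 < d)%N -> nondegenerate X w p -> p 0 i != 1.
Proof.
move=> d_gt0 [feas_p fp]; apply/eqP => /(feasible_point_of_eq1 feas_p) pE.
by move: fp; rewrite pE objective_point // ltxx.
Qed.

(** For feasible [p] the points of the segment from [p] to the vertex [i] are
lifts of [p] with parameter between [p 0 i] and 1, and the candidate is the best
of all lifts with parameter between 0 and 1. *)
Lemma pstar_max (R : realType) (N d : nat) (X : 'M[R]_(N, d.+1))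
    (w p : 'rV[R]_N) (i : 'I_N) :
  (0 < d)%N -> (forall j, 0 <= w 0 j) -> nondegenerate X w p ->
  feasible (pstar X w p i) /\
  forall t, 0 <= t <= 1 ->
    objective X w (mix p i t) <= objective X w (pstar X w p i).
Proof.
move=> d_gt0 w0 nd_p; have pi1 := nondegenerate_neq1 i d_gt0 nd_p.
have feas_p := nd_p.1.
have b_ge0 : 0 <= coef_b X w p i.
  rewrite coef_bE // objective_ge0 //.
  by apply: (feasible_lift_alloc pi1 _ feas_p).1; rewrite lexx ler01.
have [z01 zmax] := lifted_poly_max (coef_a X w p i) d_gt0 b_ge0.
split=> [|t /andP[t0 t1]]; first exact: feasible_lift_alloc.
rewrite mix_lift_alloc // /pstar -!/(lifted_objective _ _ _ _ _).
rewrite !lifted_objectiveE //; apply: zmax.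
have p0 := feas_p.1 i; have p1 := feasible_le1 i feas_p.
by apply/andP; split; nra.
Qed.

Lemma pstar_nondegenerate (R : realType) (N d : nat) (X : 'M[R]_(N, d.+1))
    (w p : 'rV[R]_N) (i : 'I_N) :
  (0 < d)%N -> (forall j, 0 <= w 0 j) -> nondegenerate X w p ->
  nondegenerate X w (pstar X w p i) /\
  objective X w p <= objective X w (pstar X w p i).
Proof.
move=> d_gt0 w0 nd_p; have [feas_s smax] := pstar_max i d_gt0 w0 nd_p.
have f_le : objective X w p <= objective X w (pstar X w p i).
  have := smax 0; rewrite lexx ler01 /mix subr0 scale1r scale0r addr0.
  exact.
by do 2?split => //; apply: lt_le_trans f_le; case: nd_p.
Qed.

(** * The optimality criterion *)

(** The right derivative at t = 0 of the objective along the segment is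
[gain] - d.+1 * [objective].  If it were positive, Bernoulli's inequality would
make the objective larger at an explicit small [t]. *)
Lemma gain_le (R : realType) (N d : nat) (X : 'M[R]_(N, d.+1))
    (w p : 'rV[R]_N) (i : 'I_N) :
  (0 < d)%N -> 0 < objective X w p ->
  (forall t, 0 <= t <= 1 -> objective X w (mix p i t) <= objective X w p) ->
  gain X w p i <= d.+1%:R * objective X w p.
Proof.
move=> d_gt0; set f := objective X w p; set g := gain X w p i => f_gt0 le_f.
have D : d.+1%:R = d%:R + 1 :> R by rewrite -natr1.
have dR : 1 <= d%:R :> R by rewrite ler1n.
rewrite leNgt; apply/negP => gap.
pose e := g - d.+1%:R * f.
have e_gt0 : 0 < e by rewrite subr_gt0.
have gf_e : e <= g - f by rewrite lerD2l lerN2 ler_peMl ?ler1n // ltW.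
have gf_gt0 : 0 < g - f := lt_le_trans e_gt0 gf_e.
(* After division by [t], the increase along the segment is at least
   [e - d * t * (g - f)]; this [t] makes the subtracted term [e / 2]. *)
pose t := e / (2 * d%:R * (g - f)).
have dt : d%:R * t = e / (g - f) / 2.
  by rewrite /t; field; rewrite !gt_eqF // (lt_le_trans ltr01).
have t_gt0 : 0 < t by rewrite divr_gt0 // !mulr_gt0 // (lt_le_trans ltr01).
have dt_le : d%:R * t <= 1 / 2 by rewrite dt ler_pM2r // ler_pdivrMr // mul1r.
have t_le1 : t <= 1 by nra.
have bern : 1 - d%:R * t <= (1 - t) ^+ d.
  have := young_expr d.-1 (s := 1 - t) (t := 1) _ ler01.
  rewrite prednK // !expr1n !mulr1 subr_ge0 => /(_ t_le1).
  by rewrite -subn1 natrB // => ?; lra.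
have := le_f t; rewrite (ltW t_gt0) t_le1 objective_mix // -/f -/g => /(_ isT).
apply/negP; rewrite -ltNge.
have gt0 : 0 < (1 - t) * f + t * g.
  have -> : (1 - t) * f + t * g = f + t * (g - f) by ring.
  by rewrite addr_gt0 // mulr_gt0.
apply: lt_le_trans (ler_wpM2r (ltW gt0) bern); rewrite -subr_gt0.
have -> : (1 - d%:R * t) * ((1 - t) * f + t * g) - f
    = t * (e - (d%:R * t) * (g - f)) by rewrite /e D; ring.
rewrite mulr_gt0 // dt.
have -> : e / (g - f) / 2 * (g - f) = e / 2 by field; rewrite gt_eqF.
lra.
Qed.

(** By [det_rank1_unit], the gain at [i] is [objective] times [w 0 i] times the
quadratic form of the inverse matrix at row [i] of [X]; the trace collects these
values linearly in [q]. *)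
Lemma trace_information (R : realType) (N d : nat) (X : 'M[R]_(N, d.+1))
    (w p q : 'rV[R]_N) :
  objective X w p != 0 ->
  objective X w p * \tr (invmx (information X w p) *m information X w q) =
  \sum_i q 0 i * gain X w p i.
Proof.
move=> fp; rewrite (information_sum X w q) mulmx_sumr raddf_sum mulr_sumr.
have unitP : information X w p \in unitmx by rewrite unitmxE unitfE.
apply: eq_bigr => i _ /=; rewrite /gain /objective -!/(information _ _ _).
rewrite informationD information_point det_rank1_unit //.
rewrite [w 0 i * _]mulrC -scalerA scalemxAl -scalemxAr linearZ /=.
rewrite mulmxA mxtrace_mulC [row i X *m _]mx11_scalar mxtrace_scalar mulr1n.
by rewrite mulmxA; ring.
Qed.

(** The global optimality criterion: testing the directions towards the vertices
suffices, because the trace of M(p)^-1 M(q) is linear in [q]. *)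
Lemma maximizes_of_mix_le (R : realType) (N d : nat) (X : 'M[R]_(N, d.+1))
    (w p : 'rV[R]_N) :
  (0 < d)%N -> (forall i, 0 <= w 0 i) -> nondegenerate X w p ->
  (forall i t, 0 <= t <= 1 -> objective X w (mix p i t) <= objective X w p) ->
  maximizes X w p.
Proof.
move=> d_gt0 w0 [feas_p fp] le_p; split=> // q [q0 q1].
have fp_neq0 : objective X w p != 0 by rewrite gt_eqF.
have [tr_ge0] := det_le_trace_rel (information_psd X w0 feas_p.1) fp_neq0
  (information_psd X w0 q0).
move=> /le_trans; apply; rewrite ler_piMr ?(ltW fp) // exprn_ile1 //.
  by rewrite divr_ge0.
rewrite ler_pdivrMr ?ltr0n // mul1r -(ler_pM2l fp) trace_information //.
have -> : objective X w p * d.+1%:R =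
    \sum_i q 0 i * (d.+1%:R * objective X w p).
  by rewrite -mulr_suml q1 mul1r mulrC.
apply: ler_sum => i _.
by rewrite ler_wpM2l // gain_le // => t; apply: le_p.
Qed.

Lemma stationary_maximizes (R : realType) (N d : nat) (X : 'M[R]_(N, d.+1))
    (w p : 'rV[R]_N) :
  (0 < d)%N -> (forall i, 0 <= w 0 i) -> nondegenerate X w p ->
  stationary X w p -> maximizes X w p.
Proof.
move=> d_gt0 w0 nd_p stat_p; apply: maximizes_of_mix_le => // i t t01.
by rewrite -(stat_p i) (pstar_max i d_gt0 w0 nd_p).2.
Qed.

(** * Iterations *)

Lemma sequential_nondegenerate (R : realType) (N d : nat)
    (X : 'M[R]_(N, d.+1)) (w p : 'rV[R]_N) (s : {perm 'I_N}) :
  (0 < d)%N -> (forall i, 0 <= w 0 i) -> nondegenerate X w p ->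
  nondegenerate X w (sequential_iteration X w s p) /\
  objective X w p <= objective X w (sequential_iteration X w s p).
Proof.
move=> d_gt0 w0; rewrite /sequential_iteration.
elim: [seq s i | i <- enum 'I_N] p => //= i l IH p nd_p.
have [nd_s le_s] := pstar_nondegenerate i d_gt0 w0 nd_p.
by have [nd_l] := IH _ nd_s; split=> //; apply: le_trans le_s _.
Qed.

Lemma has_largest (R : realDomainType) (T : eqType) (f : T -> R) (c : seq T) :
  (0 < size c)%N -> has (fun q => all (fun q' => f q' <= f q) c) c.
Proof.
elim: c => // x c IH _; have [c0|c_gt0] := posnP (size c).
  by rewrite (size0nil c0) /= lexx.
have /hasP[q qc /allP qmax] := IH c_gt0.
have [xq|/ltW qx] := leP (f x) (f q).
  apply/hasP; exists q; first by rewrite inE qc orbT.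
  by rewrite /= xq; apply/allP.
apply/hasP; exists x; first by rewrite mem_head.
by rewrite /= lexx; apply/allP => y /qmax /le_trans; apply.
Qed.

Lemma simultaneous_cases (R : realType) (N d : nat) (X : 'M[R]_(N, d.+1))
    (w p : 'rV[R]_N) :
  let r := simultaneous_iteration X w p in
  (r = p \/ exists i, r = pstar X w p i) /\
  forall i, objective X w (pstar X w p i) <= objective X w r.
Proof.
rewrite /simultaneous_iteration /=.
set c := [seq pstar X w p i | i <- enum 'I_N].
have in_c i : pstar X w p i \in c by rewrite map_f // mem_enum.
case: ifPn => [better|/hasPn worse]; last first.
  by split=> [|i]; [left | rewrite leNgt worse].
have c_gt0 : (0 < size c)%N by case: (c) better.
have max_c := has_largest (objective X w) c_gt0.
split=> [|i]; last by have /allP := nth_find p max_c; apply.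
right; set l := find _ c.
have : nth p c l \in c by rewrite mem_nth // -has_find.
by move=> /mapP[i _ ->]; exists i.
Qed.

Lemma simultaneous_nondegenerate (R : realType) (N d : nat)
    (X : 'M[R]_(N, d.+1)) (w p : 'rV[R]_N) :
  (0 < d)%N -> (forall i, 0 <= w 0 i) -> nondegenerate X w p ->
  nondegenerate X w (simultaneous_iteration X w p) /\
  objective X w p <= objective X w (simultaneous_iteration X w p).
Proof.
move=> d_gt0 w0 nd_p.
have [[->|[i ->]] _] := simultaneous_cases X w p; first by [].
exact: pstar_nondegenerate.
Qed.

(** * Convergence *)

Lemma continuous_objective (R : realType) (N d : nat) (X : 'M[R]_(N, d.+1))
    (w : 'rV[R]_N) :
  continuous (objective X w).
Proof.
have -> : objective X w = fun p =>
    \sum_(s : {perm 'I_d.+1}) (-1) ^+ s *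
      \prod_a \sum_i X i a * (w 0 i * p 0 i) * X i (s a).
  apply/funext => p; apply: eq_bigr => s _; congr (_ * _).
  apply: eq_bigr => a _; rewrite mxE; apply: eq_bigr => i _.
  by rewrite mul_mx_diag !mxE.
have entry_cont a b : continuous (fun p : 'rV[R]_N =>
    \sum_i X i a * (w 0 i * p 0 i) * X i b).
  apply: continuous_big => [|i _ p]; first exact: add_continuous.
  apply: (@cvgMr_tmp _ _ (nbhs p)); apply: (@cvgMl_tmp _ _ (nbhs p)).
  by apply: (@cvgMl_tmp _ _ (nbhs p)); exact: coord_continuous.
apply: continuous_big => [|s _ p]; first exact: add_continuous.
apply: (@cvgMl_tmp _ _ (nbhs p)); move: p.
apply: continuous_big => [|a _]; first exact: mul_continuous.
exact: entry_cont.
Qed.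

Lemma continuous_mix (R : realType) (N : nat) (i : 'I_N) (t : R) :
  continuous (fun p => mix p i t).
Proof.
move=> p; apply: (@cvgD _ _ _ (nbhs p)); last first.
  by apply: cvg_cst.
by apply: (@cvgZl_tmp _ _ _ (nbhs p)); exact: cvg_id.
Qed.

Lemma compact_feasible (R : realType) (N : nat) :
  compact (@feasible R N : set 'rV[R]_N).
Proof.
have cube : compact [set v : 'rV[R]_N | forall i, v ord0 i \in `[0 : R, 1]].
  apply: (@rV_compact _ _ (fun=> `[0 : R, 1]%classic)).
  by move=> _; apply: segment_compact.
apply: (subclosed_compact _ cube).
- have -> : @feasible R N = \bigcap_i [set p : 'rV[R]_N | 0 <= p 0 i] `&`
     (fun p : 'rV[R]_N => \sum_i p 0 i) @^-1` [set 1].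
    apply/seteqP; split => p.
      by move=> [p0 p1]; split=> // i _; apply: p0.
    by move=> [p0 p1]; split=> // i; apply: p0.
  apply: closedI.
    apply: closed_bigI => i _.
    apply: (@closed_comp _ _ (fun p : 'rV[R]_N => p 0 i) [set x | 0 <= x]).
      by move=> p _; exact: coord_continuous.
    exact: closed_ge.
  apply: closed_comp => [p _|]; last exact: closed_eq.
  apply: continuous_big => [|i _]; first exact: add_continuous.
  exact: coord_continuous.
- by move=> p feas_p i /=; rewrite in_itv /= feas_p.1 feasible_le1.
Qed.

(** Continuity of the objective suffices here: the step parameter [zstar] need
not be continuous, because the candidates are only compared with the points
[mix p i t] for fixed [i] and [t]. *)
Lemma simultaneous_limit_maximum (R : realType) (N d : nat)
    (X : 'M[R]_(N, d.+1)) (w : 'rV[R]_N) (v : nat -> 'rV[R]_N) (L : R) :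
  (0 < d)%N -> (forall i, 0 <= w 0 i) ->
  (forall n, nondegenerate X w (v n)) -> 0 < L ->
  objective X w (v n) @[n --> \oo] --> L ->
  objective X w (simultaneous_iteration X w (v n)) @[n --> \oo] --> L ->
  exists2 q, maximizes X w q & objective X w q = L.
Proof.
move=> d_gt0 w0 nd_v L_gt0 fv_L rv_L.
(* A filter finer than that of the sequence and converging to a cluster point
   plays the role of a convergent subsequence. *)
pose F := v n @[n --> \oo].
have F_feas : F (@feasible R N) by exists 0%N => // n _; case: (nd_v n).
have [q [feas_q]] := @compact_feasible R N F _ F_feas.
rewrite cluster_cvgE => -[G properG [G_q FG]].
have along_G (h : 'rV[R]_N -> R) (l : R) :
    h (v n) @[n --> \oo] --> l -> h @ G --> l.
  by move=> hl A /hl; apply: FG.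
have fq : objective X w q = L.
  apply: (cvg_unique _ _ (along_G _ _ fv_L)) => //.
  exact: cvg_trans (cvg_app _ G_q) (@continuous_objective _ _ _ X w q).
exists q => //; apply: maximizes_of_mix_le => //.
  by rewrite /nondegenerate fq.
move=> i t t01; rewrite fq.
pose r p := objective X w (simultaneous_iteration X w p).
apply: (ler_cvg_to _ (along_G r _ rv_L)).
  apply: cvg_trans (cvg_app _ G_q) _.
  exact: (continuous_comp (@continuous_mix _ _ i t q)
    (@continuous_objective _ _ _ X w _)).
apply: FG; exists 0%N => // n _ /=.
apply: le_trans ((pstar_max i d_gt0 w0 (nd_v n)).2 t t01) _.
exact: (simultaneous_cases X w (v n)).2.
Qed.

Lemma lift_one_nondegenerate (R : realType) (N d : nat)
    (X : 'M[R]_(N, d.+1)) (w p0 : 'rV[R]_N) (s : nat -> {perm 'I_N}) (n : nat) :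
  (0 < d)%N -> (forall i, 0 <= w 0 i) -> nondegenerate X w p0 ->
  nondegenerate X w (lift_one X w s p0 n).
Proof.
move=> d_gt0 w0 nd0; elim: n => //= n IH.
exact: (sequential_nondegenerate _ d_gt0 w0 IH).1.
Qed.

Lemma modified_lift_one_nondegenerate (R : realType) (N d : nat)
    (X : 'M[R]_(N, d.+1)) (w p0 : 'rV[R]_N) (s : nat -> {perm 'I_N}) (n : nat) :
  (0 < d)%N -> (forall i, 0 <= w 0 i) -> nondegenerate X w p0 ->
  nondegenerate X w (modified_lift_one X w s p0 n).
Proof.
move=> d_gt0 w0 nd0; elim: n => //= n IH; case: ifP => _.
  exact: (simultaneous_nondegenerate d_gt0 w0 IH).1.
exact: (sequential_nondegenerate _ d_gt0 w0 IH).1.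
Qed.

Lemma modified_lift_one_nondecreasing (R : realType) (N d : nat)
    (X : 'M[R]_(N, d.+1)) (w p0 : 'rV[R]_N) (s : nat -> {perm 'I_N}) :
  (0 < d)%N -> (forall i, 0 <= w 0 i) -> nondegenerate X w p0 ->
  nondecreasing_seq (fun n => objective X w (modified_lift_one X w s p0 n)).
Proof.
move=> d_gt0 w0 nd0; apply/nondecreasing_seqP => n /=.
have nd_n := modified_lift_one_nondegenerate s n d_gt0 w0 nd0.
case: ifP => _; first exact: (simultaneous_nondegenerate d_gt0 w0 nd_n).2.
exact: (sequential_nondegenerate _ d_gt0 w0 nd_n).2.
Qed.

Lemma objective_bounded (R : realType) (N d : nat) (X : 'M[R]_(N, d.+1))
    (w p0 : 'rV[R]_N) :
  feasible p0 ->
  exists M, forall p, feasible p -> objective X w p <= M.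
Proof.
move=> feas0.
have [||q _ q_max] :=
  @compact_EVT_max _ _ (objective X w) _ _ (@compact_feasible R N).
- by exists p0.
- exact/continuous_subspaceT/continuous_objective.
by exists (objective X w q) => p feas_p; apply: q_max; rewrite inE.
Qed.

(** The allocations with index 10 n + 9 are those to which the simultaneous
iteration is applied; both their values and the values right after them converge
to the limit of the whole monotone sequence. *)
Lemma modified_lift_one_limit (R : realType) (N d : nat)
    (X : 'M[R]_(N, d.+1)) (w p0 : 'rV[R]_N) (s : nat -> {perm 'I_N}) :
  (0 < d)%N -> (forall i, 0 <= w 0 i) -> nondegenerate X w p0 ->
  exists q, maximizes X w q /\
    objective X w (modified_lift_one X w s p0 n) @[n --> \oo]
      --> objective X w q.
Proof.
move=> d_gt0 w0 nd0; set u := modified_lift_one X w s p0.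
have nd_u n : nondegenerate X w (u n) by exact: modified_lift_one_nondegenerate.
have incr_u : nondecreasing_seq (fun n => objective X w (u n)).
  exact: modified_lift_one_nondecreasing.
have [M M_ub] := objective_bounded X w nd0.1.
have cvg_u : cvgn (fun n => objective X w (u n)).
  apply: nondecreasing_is_cvgn => //.
  by exists M => _ [n _ <-]; apply: M_ub; case: (nd_u n).
set L := limn (fun n => objective X w (u n)) in cvg_u.
have L_gt0 : 0 < L.
  by apply: lt_le_trans nd0.2 _; exact: (nondecreasing_cvgn_le incr_u cvg_u 0).
have sub_L (k : nat -> nat) : (forall n, n <= k n)%N ->
    objective X w (u (k n)) @[n --> \oo] --> L.
  move=> k_ge; apply: (cvg_comp k (fun n => objective X w (u n))) cvg_u.
  move=> A [m _ mA]; exists m => // n /= mn; apply: mA => /=.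
  exact: leq_trans mn (k_ge n).
have [|||q q_max fq] := @simultaneous_limit_maximum _ _ _ X w
  (fun n => u (10 * n + 9)%N) L d_gt0 w0 _ L_gt0.
- by move=> n.
- by apply: sub_L => n; lia.
- have -> : (fun n =>
        objective X w (simultaneous_iteration X w (u (10 * n + 9)%N))) =
      (fun n => objective X w (u (10 * n + 9).+1)).
    apply/funext => n; rewrite /u /=.
    have -> // : (10 %| (10 * n + 9).+1)%N.
    by rewrite -addnS dvdn_addr ?dvdn_mulr.
  by apply: sub_L => n; lia.
by exists q; rewrite fq.
Qed.

Theorem theorem3p3p3 (R : realType) (k d : nat)
    (x : 'I_(2 ^ k) -> 'rV[R]_k) (X : 'M[R]_(2 ^ k, d.+1))
    (w : 'rV[R]_(2 ^ k))
    (k_ge1 : (1 <= k)%N) (d_gek : (k <= d)%N)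
    (x_conditions : lists_conditions x) (X_model : model_matrix x X)
    (w_ge0 : forall i, 0 <= w 0 i)
    (f_neq0 : exists q : 'rV[R]_(2 ^ k), feasible q /\ objective X w q <> 0) :
  (forall (s : nat -> {perm 'I_(2 ^ k)}) (p0 p : 'rV[R]_(2 ^ k)),
     admissible_start p0 ->
     converges_to X w (lift_one X w s p0) p \/
     converges_to X w (modified_lift_one X w s p0) p ->
     maximizes X w p) /\
  (forall (s : nat -> {perm 'I_(2 ^ k)}) (p0 : 'rV[R]_(2 ^ k)),
     admissible_start p0 ->
     (exists p : 'rV[R]_(2 ^ k),
        converges_to X w (modified_lift_one X w s p0) p) \/
     (exists pmax : 'rV[R]_(2 ^ k),
        maximizes X w pmax /\
        objective X w (modified_lift_one X w s p0 n) @[n --> \oo]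
          --> objective X w pmax)).
Proof.
have d_gt0 : (0 < d)%N := leq_trans k_ge1 d_gek.
have [q [_ fq]] := f_neq0.
have start p0 : admissible_start p0 -> nondegenerate X w p0.
  move=> [feas0 p01]; split=> //; apply: objective_gt0 fq => // i.
  by case/andP: (p01 i).
split=> [s p0 p /start nd0|s p0 /start nd0]; last first.
  by right; exact: modified_lift_one_limit.
case=> -[n [<- stat]]; apply: stationary_maximizes stat => //.
  exact: lift_one_nondegenerate.
exact: modified_lift_one_nondegenerate.
Qed.
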